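(* For every nonnegative integer $n$, there exists an $\mathrm{RDSQS}(2^{2n+1}+2)$.
   Context: A Steiner quadruple system $\mathrm{SQS}(v)$ is a pair $(X,\mathcal{B})$ with $|X|=v$ and $\mathcal{B}$ a set of $4$-subsets of $X$ (blocks) such that every $3$-subset of $X$ lies in exactly one block. For $x\in X$, the derived design at $x$ is $(X\setminus\{x\},\{B\setminus\{x\}: x\in B\in\mathcal{B}\})$, which is a Steiner triple system $\mathrm{STS}(v-1)$ (every pair of points in exactly one $3$-subset block). A parallel class of a set $Y$ is a set of pairwise disjoint blocks whose union is $Y$; a design is resolvable if its block set can be partitioned into parallel classes of its point set (a resolvable $\mathrm{STS}$ is a Kirkman triple system). An $\mathrm{RDSQS}(v)$ is an $\mathrm{SQS}(v)$ whose derived design at every point is resolvable. *)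

(* Defs.v *)
From mathcomp Require Import all_boot.
Set Implicit Arguments. Unset Strict Implicit. Unset Printing Implicit Defensive.

Definition steiner_system (T : finType) (t k : nat) (X : {set T})
    (B : {set {set T}}) : Prop :=
  (forall b, b \in B -> b \subset X /\ #|b| = k) /\
  (forall S : {set T}, S \subset X -> #|S| = t ->
     #|[set b in B | S \subset b]| = 1).

Definition is_SQS (T : finType) (X : {set T}) (B : {set {set T}}) : Prop :=
  steiner_system 3 4 X B.

Definition is_STS (T : finType) (X : {set T}) (B : {set {set T}}) : Prop :=
  steiner_system 2 3 X B.

Definition derived_points (T : finType) (X : {set T}) (x : T) : {set T} :=
  X :\ x.
Definition derived_blocks (T : finType) (B : {set {set T}}) (x : T)
  : {set {set T}} :=
  [set b :\ x | b in [set b in B | x \in b]].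

Definition parallel_class (T : finType) (Y : {set T}) (P : {set {set T}})
  : Prop :=
  trivIset P /\ cover P = Y.

Definition resolvable (T : finType) (X : {set T}) (B : {set {set T}}) : Prop :=
  exists R : {set {set {set T}}},
    partition R B /\ (forall P, P \in R -> parallel_class X P).

Definition is_RDSQS (T : finType) (X : {set T}) (B : {set {set T}}) : Prop :=
  is_SQS X B /\
  forall x, x \in X -> resolvable (derived_points X x) (derived_blocks B x).

Definition RDSQS_exists (v : nat) : Prop :=
  exists B : {set {set 'I_v}}, is_RDSQS [set: 'I_v] B.

(* Main.v *)
Require Import Defs.
From mathcomp Require Import all_boot.
From HB Require Import structures.
From mathcomp Require Import all_algebra.
Set Implicit Arguments. Unset Strict Implicit. Unset Printing Implicit Defensive.
Import GRing.Theory.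

(** Let V = F_4^n.  The points are two copies x_0, x_1 of each x in V and two
points at infinity, oo_0 and oo_1.  On every affine line l of V over F_4, put a
copy of the SQS(10) on the points over l and the points at infinity, arranged so
that it contains the blocks {x_0, x_1, oo_0, oo_1}.  The triples over three
non-collinear points x, y, z are covered by the blocks {x_i, y_j, z_k, t_m} with
t = x + y + z and i + j + k + m = twist (x + y) (x + z).

The classes of the derived design at oo_b are indexed by V: the class of x is the
union, over the lines through x, of the parallel class of {oo_(1-b), x_0, x_1} in
the KTS(9) on that line.  At a finite point, translated to 0, one class consists of
the triples that lie over a line in the parallel class of {oo_0, oo_1, 0_1}.  The other
classes are indexed by V - {0}: class c consists of a further parallel class of the
KTS(9) on the line of c, completed by a holey parallel class of a Kirkman frame of type
6^5 on each F_4-plane through that line.  Hence only SQS(10) and one such frame have to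
be checked by computation; the frame does not exist for twist = 0, so the twist comes,
like the frame itself, from a computer search. *)

(** * Resolved quadruple systems as functions *)

(* The point q x y z completes x, y, z to a block, and chi a y z names the parallel
   class, in the derived design at a, of the triple through y and z.  By chi_inj two
   triples through y have different names, so if there are just enough names then
   every name occurs at y. *)
Record resolved_quads (T K : finType) (q : T -> T -> T -> T)
    (chi : T -> T -> T -> K) : Prop := ResolvedQuads {
  q_new : forall x y z, uniq [:: x; y; z] -> q x y z \notin [:: x; y; z];
  q_swap12 : forall x y z, uniq [:: x; y; z] -> q y x z = q x y z;
  q_swap23 : forall x y z, uniq [:: x; y; z] -> q x z y = q x y z;
  q_inv : forall x y z, uniq [:: x; y; z] -> q x y (q x y z) = z;
  chi_swap : forall a y z, uniq [:: a; y; z] -> chi a z y = chi a y z;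
  chi_q : forall a y z, uniq [:: a; y; z] -> chi a y (q a y z) = chi a y z;
  chi_inj : forall a y z z', uniq [:: a; y; z] -> uniq [:: a; y; z'] ->
    chi a y z = chi a y z' -> z' \in [:: z; q a y z] }.

Section ResolvedQuads.
Variables (T K : finType) (q : T -> T -> T -> T) (chi : T -> T -> T -> K).
Hypothesis rq : resolved_quads q chi.

Lemma uniq3P (x y z : T) :
  reflect [/\ x <> y, x <> z & y <> z] (uniq [:: x; y; z]).
Proof.
rewrite /= !inE negb_or andbT -andbA.
by apply: (iffP and3P) => -[]; [move=> /eqP ? /eqP ? /eqP | move=> /eqP ? /eqP ? /eqP].
Qed.

Lemma q_perms x y z : uniq [:: x; y; z] ->
  [/\ q x z y = q x y z, q y x z = q x y z, q y z x = q x y z,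
      q z x y = q x y z & q z y x = q x y z].
Proof.
move=> u; have /uniq3P[xy xz yz] := u.
have u2 : uniq [:: y; x; z] by apply/uniq3P; split=> // /esym.
have u3 : uniq [:: x; z; y] by apply/uniq3P; split=> // /esym.
have e1 := q_swap23 rq u; have e2 := q_swap12 rq u.
have e3 := q_swap23 rq u2; have e4 := q_swap12 rq u3.
have u4 : uniq [:: y; z; x] by apply/uniq3P; split=> // /esym.
have e5 := q_swap12 rq u4.
by split; congruence.
Qed.

Definition quad x y z : {set T} := [set x; y; z; q x y z].

Lemma mem_quad x y z t :
  (t \in quad x y z) = [|| t == x, t == y, t == z | t == q x y z].
Proof. by rewrite !inE -!orbA. Qed.

(** Permuting arguments and undoing [q] by [q_inv] shows that any three of the four points are
    completed by the remaining one. Of the 64 choices of [u], [v], [w], those with a repetition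
    contradict distinctness. *)
Lemma quad_closed x y z u v w : uniq [:: x; y; z] -> uniq [:: u; v; w] ->
  u \in quad x y z -> v \in quad x y z -> w \in quad x y z ->
  q u v w \in quad x y z.
Proof.
move=> uxyz uuvw; have /uniq3P[xy xz yz] := uxyz.
have := q_new rq uxyz; rewrite !inE !negb_or => /and3P[/eqP dx /eqP dy /eqP dz].
have [e1 e2 e3 e4 e5] := q_perms uxyz.
have ez := q_inv rq uxyz.
have u2 : uniq [:: x; z; y] by apply/uniq3P; split=> // /esym.
have ey := q_inv rq u2; rewrite e1 in ey.
have u3 : uniq [:: y; z; x] by apply/uniq3P; split=> // /esym.
have ex := q_inv rq u3; rewrite e3 in ex.
have [] := @q_perms x y (q x y z); first by apply/uniq3P; split=> // /esym.
rewrite ez => f1 f2 f3 f4 f5.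
have [] := @q_perms x z (q x y z); first by apply/uniq3P; split=> // /esym.
rewrite ey => g1 g2 g3 g4 g5.
have [] := @q_perms y z (q x y z); first by apply/uniq3P; split=> // /esym.
rewrite ex => h1 h2 h3 h4 h5.
have /uniq3P[uv uw vw] := uuvw.
rewrite -!orbA.
by move=> /or4P[]/eqP ? /or4P[]/eqP ? /or4P[]/eqP ?; subst u v w;
  rewrite ?(ex, ey, ez, e1, e2, e3, e4, e5, f1, f2, f3, f4, f5,
    g1, g2, g3, g4, g5, h1, h2, h3, h4, h5) ?eqxx ?orbT //; congruence.
Qed.

Lemma card_quad x y z : uniq [:: x; y; z] -> #|quad x y z| = 4.
Proof.
move=> u; have /card_uniqP c4 : uniq [:: q x y z; x; y; z].
  by rewrite cons_uniq u (q_new rq u).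
rewrite -[RHS]/(size [:: q x y z; x; y; z]) -c4; apply: eq_card => t; rewrite !inE.
by case: (t == x); case: (t == y); case: (t == z); case: (t == q x y z).
Qed.

Lemma quad_eq x y z u v w : uniq [:: x; y; z] -> uniq [:: u; v; w] ->
  u \in quad x y z -> v \in quad x y z -> w \in quad x y z ->
  quad u v w = quad x y z.
Proof.
move=> ux uu hu hv hw; apply/eqP; rewrite eqEcard !card_quad // leqnn andbT.
apply/subsetP=> t; have := quad_closed ux uu hu hv hw.
by rewrite (mem_quad u) => hq /or4P[]/eqP->.
Qed.

Definition quads : {set {set T}} :=
  [set b | [exists x, exists y, exists z, uniq [:: x; y; z] && (b == quad x y z)]].

Lemma quadsP b : reflect (exists x y z, uniq [:: x; y; z] /\ b = quad x y z)
  (b \in quads).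
Proof.
rewrite inE; apply: (iffP existsP).
  by move=> [x /existsP[y /existsP[z /andP[u /eqP->]]]]; exists x, y, z.
move=> [x [y [z [u ->]]]]; exists x; apply/existsP; exists y.
by apply/existsP; exists z; rewrite u eqxx.
Qed.

Lemma quads_SQS : is_SQS [set: T] quads.
Proof.
split=> [b /quadsP[x [y [z [u ->]]]]|S _ S3].
  by rewrite subsetT card_quad.
have [x [y [z [u eS]]]] : exists x y z, uniq [:: x; y; z] /\ S = [set x; y; z].
  move: S3; rewrite cardE => S3.
  case E : (enum S) S3 => [|x [|y [|z []]]] //= _; exists x, y, z.
  split; first by have := enum_uniq S; rewrite E.
  by apply/setP=> t; rewrite -mem_enum E !inE orbA.
apply/eqP/cards1P; exists (quad x y z); apply/setP=> b; rewrite inE in_set1.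
apply/andP/eqP=> [[/quadsP[x' [y' [z' [u' ->]]]] sub]|->].
  by apply/esym/quad_eq => //; apply: (subsetP sub); rewrite eS !inE eqxx ?orbT.
split; first by apply/quadsP; exists x, y, z.
by apply/subsetP=> t; rewrite eS !inE => ->.
Qed.

(** * The derived design at a point and its colour classes *)

Hypothesis cardT : #|T| = #|K|.*2.+2.
Variable a : T.

Definition triple y z : {set T} := [set y; z; q a y z].

Lemma quadD1 y z : uniq [:: a; y; z] -> quad a y z :\ a = triple y z.
Proof.
move=> u; have /uniq3P[ay az yz] := u.
have := q_new rq u; rewrite !inE !negb_or => /and3P[/eqP da _ _].
apply/setP=> t; rewrite !inE; case: (t =P a) => [->|] //=.
by apply/esym/negP; rewrite -orbA => /or3P[] /eqP; congruence.
Qed.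

Lemma triple_eq y z u : uniq [:: a; y; z] -> u \in triple y z -> u != y ->
  [/\ uniq [:: a; y; u], triple y u = triple y z & chi a y u = chi a y z].
Proof.
move=> uyz; have /uniq3P[ay az yz] := uyz.
have := q_new rq uyz; rewrite !inE !negb_or => /and3P[/eqP da /eqP dy /eqP dz].
move=> /orP[/orP[]|]/eqP-> //; rewrite ?eqxx // => _.
have uyd : uniq [:: a; y; q a y z] by apply/uniq3P; split=> // /esym.
split=> //; last exact: (chi_q rq).
by rewrite /triple (q_inv rq uyz); apply/setP=> t; rewrite !inE orbAC.
Qed.

Lemma triple_sym y z : uniq [:: a; y; z] ->
  [/\ uniq [:: a; z; y], triple z y = triple y z & chi a z y = chi a y z].
Proof.
move=> u; have /uniq3P[ay az yz] := u; split; last exact: (chi_swap rq).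
  by apply/uniq3P; split=> // /esym.
rewrite /triple (q_swap23 rq u).
by apply/setP=> t; rewrite !inE (orbC (t == z)).
Qed.

Lemma triple_through y z u : uniq [:: a; y; z] -> u \in triple y z ->
  exists v, [/\ uniq [:: a; u; v], triple y z = triple u v & chi a y z = chi a u v].
Proof.
move=> uyz hu; have [->|uy] := eqVneq u y; first by exists z.
have [u1 <- <-] := triple_eq uyz hu uy.
by exists y; have [-> -> ->] := triple_sym u1.
Qed.

(** Any two points of a triple generate it with the same colour, so a triple lies in only one colour
    class. *)
Lemma triple_color y z y' z' : uniq [:: a; y; z] -> uniq [:: a; y'; z'] ->
  triple y z = triple y' z' -> chi a y z = chi a y' z'.
Proof.
move=> u u' e; have hy : y' \in triple y z by rewrite e !inE eqxx.
have [v [uv e1 ->]] := triple_through u hy.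
have hv : z' \in triple y' v by rewrite -e1 e !inE eqxx orbT.
have /uniq3P[_ _ yz'] := u'.
have /eqP zy' : z' <> y' by move/esym.
by have [_ _ ->] := triple_eq uv hv zy'.
Qed.

(** Counting: besides [a] and [y] there are twice as many points as colours, and by [chi_inj] each
    colour is taken at no more than two of them, so none is missing. *)
Lemma chi_surj y c : y != a -> exists z, uniq [:: a; y; z] /\ chi a y z = c.
Proof.
move=> ya; pose D := [set z | uniq [:: a; y; z]].
have cD : #|D| = #|K|.*2.
  have -> : D = ~: [set a; y].
    apply/setP=> z; rewrite !inE /= !inE !negb_or andbT (eq_sym z a) (eq_sym z y).
    by rewrite eq_sym ya.
  by rewrite cardsCs setCK cardT cards2 eq_sym ya !subSS subn0.
have [z hz|none] := pickP (fun z => (z \in D) && (chi a y z == c)).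
  by exists z; move: hz; rewrite inE => /andP[u /eqP].
suff : #|D| <= (#|K|.-1).*2.
  (* [c] shows that [K] is not empty, so its predecessor is strictly smaller. *)
  rewrite cD leq_double; case E : #|K| => [|k]; last by rewrite ltnn.
  by have := card0_eq E c; rewrite inE.
rewrite -sum1_card (partition_big (chi a y) (predC1 c)) /=; last first.
  by move=> z hz; apply/negP=> e; have := none z; rewrite hz e.
rewrite -(cardC1 c) -muln2 -sum_nat_const; apply: leq_sum => k _.
rewrite sum1_card.
have [z0 /andP[z0D /eqP z0k]|e] := pickP (fun z => (z \in D) && (chi a y z == k)).
  apply: (@leq_trans #|[set z0; q a y z0]|); last by rewrite cards2; case: eqP.
  apply: subset_leq_card; apply/subsetP=> z; rewrite inE => /andP[zD /eqP zk].
  move: z0D zD; rewrite !inE => u u'.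
  by have := chi_inj rq u u'; rewrite zk z0k !inE => /(_ erefl).
by rewrite eq_card0 // => z; rewrite inE; have := e z; rewrite /= inE.
Qed.

Definition color_class c : {set {set T}} :=
  [set t | [exists y, exists z,
    [&& uniq [:: a; y; z], t == triple y z & chi a y z == c]]].

Lemma color_classP c t : reflect
  (exists y z, [/\ uniq [:: a; y; z], t = triple y z & chi a y z = c])
  (t \in color_class c).
Proof.
rewrite inE; apply: (iffP existsP).
  by move=> [y /existsP[z /and3P[u /eqP-> /eqP]]]; exists y, z.
move=> [y [z [u -> e]]]; exists y; apply/existsP; exists z.
by rewrite u e !eqxx.
Qed.

Lemma derived_quadsP t : reflect (exists y z, uniq [:: a; y; z] /\ t = triple y z)
  (t \in derived_blocks quads a).
Proof.
apply: (iffP imsetP) => [[b]|[y [z [u ->]]]].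
  rewrite inE => /andP[/quadsP[x [y [z [u ->]]]] ha ->].
  have [y' [z' [u' <-]]] : exists y' z', uniq [:: a; y'; z'] /\ quad a y' z' = quad x y z.
    have mx : x \in quad x y z by rewrite !inE eqxx.
    have my : y \in quad x y z by rewrite !inE eqxx ?orbT.
    have mz : z \in quad x y z by rewrite !inE eqxx ?orbT.
    have /uniq3P[xy xz yz] := u.
    have [xa|/eqP xa] := eqVneq a x; first by exists y, z; rewrite xa.
    have [ya|/eqP ya] := eqVneq a y.
      have u' : uniq [:: a; x; z] by apply/uniq3P; split=> //; rewrite ya.
      by exists x, z; rewrite u' (quad_eq u u').
    have u' : uniq [:: a; x; y] by apply/uniq3P.
    by exists x, y; rewrite u' (quad_eq u u').
  by exists y', z'; rewrite quadD1.
exists (quad a y z); last by rewrite quadD1.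
by rewrite inE; apply/andP; split; [apply/quadsP; exists a, y, z | rewrite !inE eqxx].
Qed.

(** Triples of one colour that meet coincide by [chi_inj], and by [chi_surj] each colour reaches
    every point. *)
Lemma derived_quads_resolvable :
  resolvable (derived_points [set: T] a) (derived_blocks quads a).
Proof.
exists [set color_class c | c : K]; split.
  apply/and3P; split.
  - apply/eqP/setP=> t; apply/bigcupP/derived_quadsP.
      by move=> [_ /imsetP[c _ ->] /color_classP[y [z [u e _]]]]; exists y, z.
    move=> [y [z [u e]]]; exists (color_class (chi a y z)); first exact: imset_f.
    by apply/color_classP; exists y, z.
  - apply/trivIsetP=> _ _ /imsetP[c _ ->] /imsetP[c' _ ->] ne.
    apply/pred0P=> t /=; apply/negP.
    move=> /andP[/color_classP[y [z [u e1 e2]]] /color_classP[y' [z' [u' e1' e2']]]].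
    by move: ne; rewrite -e2 -e2' (triple_color u u') ?eqxx // -e1.
  (* A partition has no empty part, so every colour must occur; [cardT] supplies a point other than
     [a] at which to find it. *)
  - apply/imsetP=> -[c _ e0].
    have [y ya] : exists y, y != a.
      have [y ya|e] := pickP (predC1 a); first by exists y.
      have := cardC1 a; rewrite (eq_card0 e) cardT /=.
      by [].
    have [z [u ez]] := chi_surj c ya.
    have : triple y z \in color_class c by apply/color_classP; exists y, z.
    by rewrite -e0 inE.
move=> _ /imsetP[c _ ->]; split.
  apply/trivIsetP=> s t /color_classP[y [z [u -> e]]] /color_classP[y' [z' [u' -> e']]].
  apply: contraNT => /pred0Pn[x /andP[/= xs xt]].
  have [v [uv -> ev]] := triple_through u xs.
  have [v' [uv' -> ev']] := triple_through u' xt.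
  have := chi_inj rq uv uv'; rewrite -ev -ev' e e' => /(_ erefl) vv.
  have vt : v' \in triple x v by move: vv; rewrite !inE -orbA => ->; rewrite orbT.
  have /uniq3P[_ _ /eqP] := uv'; rewrite eq_sym => vx.
  by have [_ -> _] := triple_eq uv vt vx.
apply/setP=> y; rewrite !inE andbT; apply/bigcupP/idP.
  move=> [_ /color_classP[x [z [u -> _]]] yt].
  have [v [/uniq3P[/eqP + _ _] _ _]] := triple_through u yt.
  by rewrite eq_sym.
move=> ya; have [z [u e]] := chi_surj c ya.
exists (triple y z); last by rewrite !inE eqxx.
by apply/color_classP; exists y, z.
Qed.

End ResolvedQuads.

Lemma resolved_quads_RDSQS (T K : finType) q (chi : T -> T -> T -> K) :
  resolved_quads q chi -> #|T| = #|K|.*2.+2 -> RDSQS_exists #|T|.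
Proof.
move=> rq cT.
pose g : 'I_#|T| -> T := enum_val.
pose q' x y z : 'I_#|T| := enum_rank (q (g x) (g y) (g z)).
pose chi' x y z := chi (g x) (g y) (g z).
have gI : injective g by apply: enum_val_inj.
have gr x : g (enum_rank x) = x by apply: enum_rankK.
have uE x y z : uniq [:: x; y; z] -> uniq [:: g x; g y; g z].
  by rewrite -(map_inj_uniq gI).
have mE x s : (x \in s) = (g x \in map g s) by rewrite mem_map.
have rq' : resolved_quads q' chi'.
  split=> [x y z /uE u|x y z /uE u|x y z /uE u|x y z /uE u|x y z /uE u|x y z /uE u|].
  - by rewrite mE gr; apply: (q_new rq).
  - by rewrite /q' (q_swap12 rq).
  - by rewrite /q' (q_swap23 rq).
  - by rewrite /q' gr (q_inv rq) // /g enum_valK.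
  - exact: (chi_swap rq).
  - by rewrite /chi' gr (chi_q rq).
  - move=> a y z z' /uE u /uE u' e.
    by rewrite mE /= gr; apply: (chi_inj rq).
exists (quads q'); split; first exact: quads_SQS rq'.
by move=> a _; apply: (derived_quads_resolvable rq'); rewrite card_ord.
Qed.

(** * The field with four elements *)

(* The pair (h, l) encodes h w + l, where w^2 = w + 1. *)
Definition F4 := (bool * bool)%type.
HB.instance Definition _ := Finite.on F4.

Definition F4_add (x y : F4) : F4 := (x.1 (+) y.1, x.2 (+) y.2).
Definition F4_mul (x y : F4) : F4 :=
  ((x.1 && y.1) (+) (x.1 && y.2) (+) (x.2 && y.1), (x.1 && y.1) (+) (x.2 && y.2)).
(* Nonzero elements have order dividing 3, so squaring inverts them. *)
Definition F4_inv (x : F4) : F4 := (x.1, x.1 (+) x.2).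

Lemma F4_addA : associative F4_add.
Proof. by move=> [[] []] [[] []] [[] []]. Qed.
Lemma F4_addC : commutative F4_add.
Proof. by move=> [[] []] [[] []]. Qed.
Lemma F4_add0 : left_id (false, false) F4_add.
Proof. by move=> [[] []]. Qed.
Lemma F4_addN : left_inverse (false, false) id F4_add.
Proof. by move=> [[] []]. Qed.
HB.instance Definition _ :=
  GRing.isZmodule.Build F4 F4_addA F4_addC F4_add0 F4_addN.

Lemma F4_mulA : associative F4_mul.
Proof. by move=> [[] []] [[] []] [[] []]. Qed.
Lemma F4_mulC : commutative F4_mul.
Proof. by move=> [[] []] [[] []]. Qed.
Lemma F4_mul1 : left_id (false, true) F4_mul.
Proof. by move=> [[] []]. Qed.
Lemma F4_mulDl : left_distributive F4_mul F4_add.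
Proof. by move=> [[] []] [[] []] [[] []]. Qed.
Lemma F4_1neq0 : ((false, true) : F4) != (false, false).
Proof. by []. Qed.
HB.instance Definition _ := GRing.Zmodule_isComNzRing.Build F4
  F4_mulA F4_mulC F4_mul1 F4_mulDl F4_1neq0.

Lemma F4_mulV (x : F4) : (x != 0)%R -> F4_mul (F4_inv x) x = (1)%R.
Proof. by case: x => [[] []]. Qed.
Lemma F4_inv0 : F4_inv (0)%R = (0)%R.
Proof. by []. Qed.
HB.instance Definition _ := GRing.ComNzRing_isField.Build F4 F4_mulV F4_inv0.

Definition F4_code (c : F4) : nat := c.1.*2 + c.2.
(** Only the two lowest bits are read, so a longer code can be passed without reduction modulo 4. *)
Definition F4_decode (k : nat) : F4 := (odd k./2, odd k).
Definition F4_enum : seq F4 := map F4_decode (iota 0 4).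

Lemma all_F4 (p : pred F4) : all p F4_enum -> forall c, p c.
Proof. by move=> /allP h [[] []]; apply: h. Qed.

Definition class_of (cls : seq (seq (seq nat))) (y z : nat) : nat :=
  find (has (fun t => (y \in t) && (z \in t))) cls.

Definition third (cls : seq (seq (seq nat))) (y z : nat) : nat :=
  let ts := filter (fun t => (y \in t) && (z \in t)) (flatten cls) in
  head 0 (filter (fun u => u \notin [:: y; z]) (head [::] ts)).

(** * The quadruple system of order 10 *)

Definition U : finType := (F4 * bool + bool)%type.

Definition U_code (u : U) : nat :=
  match u with inl (c, i) => F4_code c + 4 * i | inr b => 8 + b end.
Definition U_decode (k : nat) : U :=
  if k < 8 then inl (F4_decode k, 3 < k) else inr (odd k).
Definition U_enum : seq U := map U_decode (iota 0 10).

(* The parallel classes of the derived designs, in the order of their colours.  The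
   codes 8 and 9 are the points at infinity, and rotating the codes 0, ..., 7 is an
   automorphism; k and k + 4 are the two copies of the same element of F4. *)
Definition classes10 (a : nat) : seq (seq (seq nat)) :=
  if a < 8 then
    map (map (map (fun k => if k < 8 then (k + a) %% 8 else k)))
      [:: [:: [:: 1; 2; 5]; [:: 3; 6; 7]; [:: 4; 8; 9]];
          [:: [:: 1; 3; 8]; [:: 2; 4; 6]; [:: 5; 7; 9]];
          [:: [:: 1; 4; 7]; [:: 2; 3; 9]; [:: 5; 6; 8]];
          [:: [:: 1; 6; 9]; [:: 2; 7; 8]; [:: 3; 4; 5]]]
  else if a == 8 then
    [:: [:: [:: 0; 4; 9]; [:: 1; 6; 7]; [:: 2; 3; 5]];
        [:: [:: 0; 2; 7]; [:: 1; 5; 9]; [:: 3; 4; 6]];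
        [:: [:: 0; 1; 3]; [:: 2; 6; 9]; [:: 4; 5; 7]];
        [:: [:: 0; 5; 6]; [:: 1; 2; 4]; [:: 3; 7; 9]]]
  else
    [:: [:: [:: 0; 4; 8]; [:: 1; 2; 7]; [:: 3; 5; 6]];
        [:: [:: 0; 2; 3]; [:: 1; 5; 8]; [:: 4; 6; 7]];
        [:: [:: 0; 5; 7]; [:: 1; 3; 4]; [:: 2; 6; 8]];
        [:: [:: 0; 1; 6]; [:: 2; 4; 5]; [:: 3; 7; 8]]].

Definition complete10_raw (a y z : U) : U :=
  U_decode (third (classes10 (U_code a)) (U_code y) (U_code z)).
Definition color10_raw (a y z : U) : F4 :=
  F4_decode (class_of (classes10 (U_code a)) (U_code y) (U_code z)).

(** Tests every field of [resolved_quads]; [row] tabulates the values for fixed [a] and [y], because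
    [chi_inj] compares two third points. *)
Definition check10_pair (a y : U) : bool :=
  let row := [seq (z, (complete10_raw a y z, color10_raw a y z)) |
                z <- U_enum & uniq [:: a; y; z]] in
  all (fun e => let: (z, (t, k)) := e in
    [&& t \notin [:: a; y; z], complete10_raw y a z == t,
        complete10_raw a z y == t, complete10_raw a y t == z,
        color10_raw a z y == k, color10_raw a y t == k
      & all (fun e' => (k == e'.2.2) ==> (e'.1 \in [:: z; t])) row]) row.

Definition check10 : bool := all (fun a => all (check10_pair a) U_enum) U_enum.

Lemma check10_true : check10. Proof. by vm_compute. Qed.

Lemma mem_U_enum u : u \in U_enum.
Proof. by case: u => [[[[] []] []]|[]]. Qed.

(* Locking keeps the unifier from evaluating the tables. *)
Definition complete10 : U -> U -> U -> U := locked complete10_raw.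
Definition color10 : U -> U -> U -> F4 := locked color10_raw.

Lemma resolved10 : resolved_quads complete10 color10.
Proof.
rewrite /complete10 /color10 -!lock.
have main a y z : uniq [:: a; y; z] ->
    [&& complete10_raw a y z \notin [:: a; y; z],
        complete10_raw y a z == complete10_raw a y z,
        complete10_raw a z y == complete10_raw a y z,
        complete10_raw a y (complete10_raw a y z) == z,
        color10_raw a z y == color10_raw a y z
      & color10_raw a y (complete10_raw a y z) == color10_raw a y z] /\
    (forall z', uniq [:: a; y; z'] -> color10_raw a y z = color10_raw a y z' ->
       z' \in [:: z; complete10_raw a y z]).
  have /allP/(_ a (mem_U_enum a))/allP/(_ y (mem_U_enum y)) := check10_true.
  rewrite /check10_pair; set row := [seq _ | z <- _ & _].
  have rowP z' : uniq [:: a; y; z'] ->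
      (z', (complete10_raw a y z', color10_raw a y z')) \in row.
    move=> u; apply/mapP; exists z' => //.
    by rewrite mem_filter u mem_U_enum.
  move=> /allP h u; have := h _ (rowP z u).
  move=> /and5P[-> -> -> -> /and3P[-> -> /allP h']]; split=> // z' u' e.
  by have := h' _ (rowP z' u'); rewrite /= e eqxx.
by split=> [x y z|x y z|x y z|x y z|a y z|a y z|a y z z'] /main[/and5P[e1
  /eqP e2 /eqP e3 /eqP e4 /andP[/eqP e5 /eqP e6]] h] //; apply: h.
Qed.

(* (false, i) stands for the i-th copy of a given point, (true, b) for the b-th
   point at infinity. *)
Definition D : finType := (bool * bool)%type.
Definition emb (X : Type) (x : X) (p : D) : X * bool + bool :=
  if p.1 then inr p.2 else inl (x, p.2).

(** In the affine plane over the field with two elements, any three distinct points sum to the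
    fourth. *)
Definition fourth (p q r : D) : D :=
  (p.1 (+) q.1 (+) r.1, p.2 (+) q.2 (+) r.2).

Definition D_enum : seq D :=
  [:: (false, false); (false, true); (true, false); (true, true)].

Lemma mem_D_enum p : p \in D_enum.
Proof. by case: p => [[] []]. Qed.

(** The normalisation that lets copies on different lines be glued: the four points over each [w]
    form a block, whose triples have colour [w] as seen from infinity and 0 as seen from a finite
    point. *)
Definition check_emb : bool :=
  all (fun w => all (fun p => all (fun q => all (fun r =>
    uniq [:: p; q; r] ==>
    (complete10_raw (emb w p) (emb w q) (emb w r) == emb w (fourth p q r)) &&
    (color10_raw (emb w p) (emb w q) (emb w r) == if p.1 then w else (false, false)))
  D_enum) D_enum) D_enum) F4_enum.

Lemma check_emb_true : check_emb. Proof. by vm_compute. Qed.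

Lemma local10_emb (w : F4) (p q r : D) : uniq [:: p; q; r] ->
  complete10 (emb w p) (emb w q) (emb w r) = emb w (fourth p q r) /\
  color10 (emb w p) (emb w q) (emb w r) = if p.1 then w else 0%R.
Proof.
rewrite /complete10 /color10 -!lock => u.
have /all_F4/(_ w)/allP/(_ p (mem_D_enum p)) := check_emb_true.
move=> /allP/(_ q (mem_D_enum q))/allP/(_ r (mem_D_enum r)).
by rewrite u => /andP[/eqP-> /eqP->].
Qed.

(** * The Kirkman frame on the plane *)

Definition W : finType := (F4 * F4)%type.
Definition W_code (c : W) (b : bool) : nat := 4 * F4_code c.1 + F4_code c.2 + 16 * b.
Definition W_decode (k : nat) : W := (F4_decode (k %/ 4), F4_decode k).
Definition W_enum : seq W := map W_decode (iota 0 16).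

Lemma mem_W_enum c : c \in W_enum.
Proof. by case: c => [[[] []] [[] []]]. Qed.

Definition WB_enum : seq (W * bool) :=
  [seq (c, false) | c <- W_enum] ++ [seq (c, true) | c <- W_enum].

Lemma mem_WB_enum p : p \in WB_enum.
Proof.
by case: p => c []; rewrite mem_cat map_f ?orbT // mem_W_enum.
Qed.

(* Class number k is the holey parallel class coloured by W_decode k; it misses
   the line spanned by W_decode k. *)
Definition frame_classes : seq (seq (seq nat)) :=
  [:: [::];
   [:: [:: 4; 10; 14]; [:: 5; 8; 13]; [:: 6; 25; 31]; [:: 7; 11; 12];
       [:: 9; 20; 29]; [:: 15; 23; 24]; [:: 21; 27; 30]; [:: 22; 26; 28]];
   [:: [:: 4; 15; 27]; [:: 5; 11; 30]; [:: 6; 8; 14]; [:: 7; 24; 31];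
       [:: 9; 21; 28]; [:: 10; 12; 22]; [:: 13; 20; 25]; [:: 23; 26; 29]];
   [:: [:: 4; 11; 31]; [:: 5; 24; 29]; [:: 6; 9; 15]; [:: 7; 27; 28];
       [:: 8; 22; 30]; [:: 10; 13; 23]; [:: 12; 21; 25]; [:: 14; 20; 26]];
   [:: [:: 1; 6; 7]; [:: 2; 21; 23]; [:: 3; 13; 30]; [:: 5; 14; 27];
       [:: 9; 22; 31]; [:: 10; 19; 25]; [:: 11; 17; 26]; [:: 15; 18; 29]];
   [:: [:: 1; 8; 25]; [:: 2; 12; 14]; [:: 3; 24; 27]; [:: 4; 9; 13];
       [:: 6; 18; 20]; [:: 7; 17; 22]; [:: 11; 23; 28]; [:: 19; 29; 30]];
   [:: [:: 1; 9; 24]; [:: 2; 5; 7]; [:: 3; 25; 26]; [:: 4; 17; 21];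
       [:: 8; 23; 31]; [:: 10; 20; 30]; [:: 12; 15; 19]; [:: 14; 18; 28]];
   [:: [:: 1; 4; 5]; [:: 2; 29; 31]; [:: 3; 21; 22]; [:: 6; 12; 26];
       [:: 8; 19; 27]; [:: 10; 18; 24]; [:: 11; 15; 20]; [:: 13; 17; 28]];
   [:: [:: 1; 30; 31]; [:: 2; 9; 11]; [:: 3; 14; 29]; [:: 5; 18; 23];
       [:: 6; 19; 21]; [:: 7; 13; 26]; [:: 10; 17; 27]; [:: 15; 22; 25]];
   [:: [:: 1; 26; 27]; [:: 2; 13; 15]; [:: 3; 12; 31]; [:: 4; 18; 22];
       [:: 5; 17; 20]; [:: 6; 10; 28]; [:: 8; 21; 29]; [:: 11; 19; 24]];
   [:: [:: 1; 12; 13]; [:: 2; 28; 30]; [:: 3; 8; 11]; [:: 4; 25; 29];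
       [:: 6; 17; 23]; [:: 7; 19; 20]; [:: 9; 18; 27]; [:: 14; 22; 24]];
   [:: [:: 1; 20; 21]; [:: 2; 24; 26]; [:: 3; 9; 10]; [:: 4; 19; 23];
       [:: 5; 25; 28]; [:: 7; 8; 15]; [:: 12; 18; 30]; [:: 14; 17; 31]];
   [:: [:: 1; 22; 23]; [:: 2; 25; 27]; [:: 3; 5; 6]; [:: 7; 10; 29];
       [:: 9; 19; 26]; [:: 11; 14; 21]; [:: 13; 18; 31]; [:: 15; 17; 30]];
   [:: [:: 1; 14; 15]; [:: 2; 8; 10]; [:: 3; 20; 23]; [:: 4; 26; 30];
       [:: 5; 9; 12]; [:: 7; 18; 21]; [:: 17; 24; 25]; [:: 19; 28; 31]];
   [:: [:: 1; 10; 11]; [:: 2; 4; 6]; [:: 3; 15; 28]; [:: 5; 19; 22];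
       [:: 8; 18; 26]; [:: 12; 17; 29]; [:: 13; 21; 24]; [:: 20; 27; 31]];
   [:: [:: 1; 28; 29]; [:: 2; 20; 22]; [:: 3; 4; 7]; [:: 6; 24; 30];
       [:: 8; 9; 17]; [:: 11; 18; 25]; [:: 12; 23; 27]; [:: 13; 14; 19]]].

(** Codes above 15 are second copies, so this bit tells in which copy the triple through the first
    copies of [c] and [c'] ends. It is the twist in coordinates. *)
Definition frame_third_raw (c c' : W) : bool :=
  15 < third frame_classes (W_code c false) (W_code c' false).
Definition frame_color_raw (c : W) (b : bool) (c' : W) (b' : bool) : W :=
  W_decode (class_of frame_classes (W_code c b) (W_code c' b')).

Definition indepW (c c' : W) : bool := (c.1 * c'.2 != c.2 * c'.1)%R.
Definition addW (c c' : W) : W := ((c.1 + c'.1)%R, (c.2 + c'.2)%R).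

(** The third point is taken to be [t], over [c + c']. The condition [indepW c k] expresses that
    class [k] misses the line spanned by [k]. *)
Definition check_frame_point (c : W) (b : bool) : bool :=
  let row := [seq (p, frame_color_raw c b p.1 p.2) |
                p <- WB_enum
                & indepW c p.1] in
  all (fun e => let: ((c', b'), k) := e in
    let t := (addW c c', b (+) b' (+) frame_third_raw c c') in
    [&& frame_third_raw c' c == frame_third_raw c c',
        frame_third_raw c (addW c c') == frame_third_raw c c',
        frame_color_raw c' b' c b == k, frame_color_raw c b t.1 t.2 == k, indepW c k
      & all (fun e' => (k == e'.2) ==> (e'.1 \in [:: (c', b'); t])) row]) row.

Definition check_frame : bool :=
  all (fun c => check_frame_point c false && check_frame_point c true) W_enum.

Lemma check_frame_true : check_frame. Proof. by vm_compute. Qed.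

Definition frame_third : W -> W -> bool := locked frame_third_raw.
Definition frame_color : W -> bool -> W -> bool -> W := locked frame_color_raw.

Lemma frameP (c c' : W) (b b' : bool) (k := frame_color c b c' b')
    (t := (addW c c', b (+) b' (+) frame_third c c')) : indepW c c' ->
  [/\ frame_third c' c = frame_third c c',
      frame_third c (addW c c') = frame_third c c',
      frame_color c' b' c b = k, frame_color c b t.1 t.2 = k & indepW c k] /\
  forall c2 b2, indepW c c2 -> frame_color c b c2 b2 = k ->
    (c2, b2) \in [:: (c', b'); t].
Proof.
rewrite /k /t /frame_third /frame_color -!lock.
have : check_frame_point c b.
  have := check_frame_true; rewrite /check_frame => /allP/(_ c (mem_W_enum c)).
  by move=> /andP[h0 h1]; case: (b).
rewrite /check_frame_point; set row := [seq _ | p <- _ & _].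
have rowP c2 b2 : indepW c c2 -> ((c2, b2), frame_color_raw c b c2 b2) \in row.
  move=> i; apply/mapP; exists (c2, b2) => //; rewrite mem_filter /= i /=.
  exact: mem_WB_enum.
move=> /allP h i; have := h _ (rowP c' b' i).
move=> /and5P[/eqP e1 /eqP e2 /eqP e3 /eqP e4 /andP[e5 /allP h']].
split=> [|c2 b2 i2 e]; first exact: And5 e1 e2 e3 e4 e5.
by have /implyP := h' _ (rowP c2 b2 i2); apply; rewrite e.
Qed.

Local Open Scope ring_scope.

(** * Lines and planes over the field with four elements *)

Definition combW (c c' k : W) : W :=
  (k.1 * c.1 + k.2 * c'.1, k.1 * c.2 + k.2 * c'.2).

(** Ties the determinant in [indepW] to linear independence; with 16 vectors this is a finite
    check. *)
Definition check_combW : bool :=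
  all (fun c => all (fun c' =>
    indepW c c' == all (fun k => (combW c c' k == (0, 0)) ==> (k == (0, 0))) W_enum)
  W_enum) W_enum.

Lemma check_combW_true : check_combW. Proof. by vm_compute. Qed.

Lemma indepWP c c' :
  reflect (forall k, combW c c' k = (0, 0) -> k = (0, 0)) (indepW c c').
Proof.
have := check_combW_true; rewrite /check_combW => /allP/(_ c (mem_W_enum c)).
move=> /allP/(_ c' (mem_W_enum c'))/eqP->.
apply: (iffP allP) => [h k /eqP e|h k _]; last by apply/implyP=> /eqP/h->.
by have /implyP/(_ e)/eqP := h k (mem_W_enum k).
Qed.

Section Geometry.
Variable n : nat.
Local Notation V := 'rV[F4]_n.
Implicit Types (x y u v : V) (l e : V * V) (c : W).

Lemma F4_add_self (a : F4) : a + a = 0.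
Proof. by case: a => [[] []]. Qed.

Lemma add_self x : x + x = 0.
Proof. by apply/rowP=> i; rewrite !mxE F4_add_self. Qed.

Lemma opp_self x : - x = x.
Proof. by apply/esym/eqP; rewrite -addr_eq0 add_self. Qed.

Lemma add_selfK x y : x + (x + y) = y.
Proof. by rewrite addrA add_self add0r. Qed.

Lemma add_eq0 x y : (x + y == 0) = (x == y).
Proof. by rewrite addr_eq0 opp_self. Qed.

Definition pt l (w : F4) : V := l.1 + w *: l.2.
Definition line l : {set V} := [set pt l w | w : F4].

Lemma pt_inj l : l.2 != 0 -> injective (pt l).
Proof.
move=> d0 w w' /addrI/eqP; rewrite -subr_eq0 -scalerBl scaler_eq0 (negPf d0) orbF.
by rewrite subr_eq0 => /eqP.
Qed.

Lemma mem_line l w : pt l w \in line l.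
Proof. exact: imset_f. Qed.

Lemma card_line l : l.2 != 0 -> #|line l| = 4%N.
Proof. by move=> d0; rewrite card_imset ?card_prod ?card_bool //; apply: pt_inj. Qed.

(** In characteristic 2 the direction from [x] to [y] is [x + y]; both lines have four points, so
    one inclusion suffices. *)
Lemma line_through l x y : l.2 != 0 -> x \in line l -> y \in line l -> x != y ->
  line (x, x + y) = line l.
Proof.
move=> d0 /imsetP[a _ ->] /imsetP[b _ ->] ab.
apply/eqP; rewrite eqEcard !card_line ?add_eq0 // andbT.
apply/subsetP=> _ /imsetP[w _ ->]; apply/imsetP; exists (a + w * (a + b)) => //.
rewrite /pt /= [_ + _ + (_ + _)]addrACA add_self add0r -scalerDl scalerA.
by rewrite -addrA -scalerDl.
Qed.

Lemma line_eq l l' x y : l.2 != 0 -> l'.2 != 0 -> x != y ->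
  x \in line l -> y \in line l -> x \in line l' -> y \in line l' -> line l = line l'.
Proof.
by move=> d0 d0' xy xl yl xl' yl'; rewrite -(line_through d0 xl yl) // (line_through d0').
Qed.

(* A canonical parametrisation of each line, independent of the points used to
   construct it. *)
Definition canon l : V * V :=
  locked (odflt l [pick l' : V * V | (l'.2 != 0) && (line l' == line l)]).
Definition valid l : bool := (l.2 != 0) && (canon l == l).

(** The choice depends on the set of points alone: [l] itself satisfies the predicate, so the
    default is not reached. *)
Lemma canon_line l l' : l.2 != 0 -> line l = line l' -> canon l = canon l'.
Proof.
rewrite /canon -!lock => d0 ll; rewrite ll; case: pickP => // /(_ l).
by rewrite d0 ll eqxx.
Qed.

Lemma canon_valid l : l.2 != 0 -> valid (canon l) /\ line (canon l) = line l.
Proof.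
move=> d0; have [d0' e] : (canon l).2 != 0 /\ line (canon l) = line l.
  by rewrite /canon -lock; case: pickP => //= l' /andP[-> /eqP].
by split=> //; rewrite /valid d0' (canon_line d0' e) eqxx.
Qed.

Lemma valid_eq l l' : valid l -> valid l' -> line l = line l' -> l = l'.
Proof.
by move=> /andP[d0 /eqP e] /andP[_ /eqP e'] /(canon_line d0); rewrite e e'.
Qed.

(** * Planes through the origin and the frames on them *)

Definition lin e c : V := c.1 *: e.1 + c.2 *: e.2.
Definition indep u v : bool := locked (injectiveb (lin (u, v))).
Definition plane e : {set V} := [set lin e c | c : W].

Lemma mem_plane e c : lin e c \in plane e.
Proof. exact: imset_f. Qed.

Lemma linB e c c' : lin e c + lin e c' = lin e (addW c c').
Proof. by rewrite /lin /= !scalerDl addrACA. Qed.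

Lemma indepP u v :
  reflect (forall k, lin (u, v) k = 0 -> k = (0, 0)) (indep u v).
Proof.
have z : lin (u, v) (0, 0) = 0 by rewrite /lin !scale0r addr0.
rewrite /indep -lock; apply: (iffP (injectiveP _)) => [h k e|h k k' /eqP].
  by apply: h; rewrite e z.
rewrite -add_eq0 linB => /eqP/h e.
have eqF (a b : F4) : a + b = 0 -> a = b by move: a b => [[] []] [[] []].
rewrite [k]surjective_pairing [k']surjective_pairing.
by rewrite (eqF _ _ (congr1 fst e)) (eqF _ _ (congr1 snd e)).
Qed.

Lemma lin_comb e c c' k : lin (lin e c, lin e c') k = lin e (combW c c' k).
Proof.
by rewrite /lin /= !scalerDr !scalerA !scalerDl addrACA.
Qed.

Lemma indep_lin e c c' : indep e.1 e.2 -> indep (lin e c) (lin e c') = indepW c c'.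
Proof.
case: e => u v /indepP h; apply/indepP/indepWP=> h' k.
  by move=> e; apply: h'; rewrite lin_comb e /lin !scale0r addr0.
by rewrite lin_comb => /h/h'.
Qed.

Lemma lin_inj e : indep e.1 e.2 -> injective (lin e).
Proof. by case: e => u v; rewrite /indep -lock => /injectiveP. Qed.

Lemma card_plane e : indep e.1 e.2 -> #|plane e| = 16%N.
Proof.
move=> /lin_inj h; rewrite card_imset //.
by rewrite !card_prod card_bool.
Qed.

Lemma plane_eq e u v : indep e.1 e.2 -> indep u v ->
  u \in plane e -> v \in plane e -> plane (u, v) = plane e.
Proof.
move=> i i' /imsetP[c _ eu] /imsetP[c' _ ev].
apply/eqP; rewrite eqEcard !card_plane // andbT.
apply/subsetP=> _ /imsetP[k _ ->].
by rewrite eu ev lin_comb mem_plane.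
Qed.

Definition coord e x : W := locked (odflt (0, 0) [pick c | lin e c == x]).

Lemma coordK e c : indep e.1 e.2 -> coord e (lin e c) = c.
Proof.
move=> /lin_inj h; rewrite /coord -lock; case: pickP => [k /eqP/h //|].
by move=> /(_ c); rewrite eqxx.
Qed.

(* A basis depending only on the span of u and v. *)
Definition chart u v : V * V :=
  locked (odflt (u, v)
    [pick e : V * V | [&& indep e.1 e.2, u \in plane e & v \in plane e]]).

Lemma mem_plane1 u v : u \in plane (u, v).
Proof. by apply/imsetP; exists (1, 0); rewrite // /lin /= scale1r scale0r addr0. Qed.

Lemma mem_plane2 u v : v \in plane (u, v).
Proof. by apply/imsetP; exists (0, 1); rewrite // /lin /= scale1r scale0r add0r. Qed.

(** A basis whose plane contains [u] and [v] is a basis of their span, so equal spans give equal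
    choice predicates. *)
Lemma chart_eq u v u' v' : indep u v -> indep u' v' ->
  plane (u, v) = plane (u', v') -> chart u v = chart u' v'.
Proof.
move=> i i' p; rewrite /chart -!lock.
have E e : [&& indep e.1 e.2, u \in plane e & v \in plane e] =
           [&& indep e.1 e.2, u' \in plane e & v' \in plane e].
  case ie : (indep _ _) => //=; apply/andP/andP => -[h1 h2].
    by rewrite -(plane_eq ie i h1 h2) p mem_plane1 mem_plane2.
  by rewrite -(plane_eq ie i' h1 h2) -p mem_plane1 mem_plane2.
rewrite (eq_pick E); case: pickP => // /(_ (u', v')).
by rewrite /= i' mem_plane1 mem_plane2.
Qed.

Lemma chartP u v (e := chart u v) : indep u v ->
  [/\ indep e.1 e.2, plane e = plane (u, v) & exists c c', u = lin e c /\ v = lin e c'].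
Proof.
move=> i.
have [ie /imsetP[c _ hu] /imsetP[c' _ hv]] :
    [/\ indep e.1 e.2, u \in plane e & v \in plane e].
  rewrite /e /chart -lock; case: pickP => [e' /and3P[]|] //= _.
  by rewrite mem_plane1 mem_plane2.
split=> //; last by exists c, c'.
by apply/esym/plane_eq => //; rewrite ?hu ?hv mem_plane.
Qed.

Definition twist u v : bool :=
  locked (let e := chart u v in frame_third (coord e u) (coord e v)).
(** The colour is returned as a vector rather than in coordinates, so that the frames on all planes
    through a line share the class names on that line. *)
Definition hue u (b : bool) v (b' : bool) : V :=
  locked (let e := chart u v in lin e (frame_color (coord e u) b (coord e v) b')).

Lemma frame_chart u v e c c' : chart u v = e -> indep e.1 e.2 ->
  u = lin e c -> v = lin e c' ->
  twist u v = frame_third c c' /\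
  forall b b', hue u b v b' = lin e (frame_color c b c' b').
Proof.
move=> ce ie eu ev.
have cu : coord e u = c by rewrite eu coordK.
have cv : coord e v = c' by rewrite ev coordK.
by rewrite /twist /hue; split=> [|b b']; rewrite -lock ce cu cv.
Qed.

(** Within one plane this is [frameP] read in the chart. The colour is independent of [u], so the
    two span the plane, and no other plane through [u] can repeat that colour. *)
Lemma hueP u v (b b' : bool) (k := hue u b v b')
    (t := (u + v, b (+) b' (+) twist u v)) : indep u v ->
  [/\ twist v u = twist u v, twist u (u + v) = twist u v,
      hue v b' u b = k, hue u b t.1 t.2 = k & indep u k] /\
  forall v2 b2, indep u v2 -> hue u b v2 b2 = k -> (v2, b2) \in [:: (v, b'); t].
Proof.
move=> i; have [ie pe [c [c' [eu ev]]]] := chartP i.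
set e := chart u v in ie pe eu ev.
have iW : indepW c c' by rewrite -(indep_lin _ _ ie) -eu -ev.
have ch c1 c2 : indepW c1 c2 ->
    twist (lin e c1) (lin e c2) = frame_third c1 c2 /\
    forall b b', hue (lin e c1) b (lin e c2) b' = lin e (frame_color c1 b c2 b').
  move=> i12; have i' : indep (lin e c1) (lin e c2) by rewrite indep_lin.
  apply: (frame_chart _ ie) => //; apply: chart_eq => //.
  by rewrite -pe; apply: plane_eq => //; apply: mem_plane.
have [[f1 f2 f3 f4 f5] f6] := frameP b b' iW.
have [tw hu] := ch _ _ iW.
have iW' : indepW c' c.
  by rewrite /indepW eq_sym in iW *; rewrite mulrC [_ * _ in X in _ != X]mulrC.
have iW2 : indepW c (addW c c').
  apply: contraNneq iW => /=; rewrite !mulrDr (mulrC c.2 c.1) => /addrI ->.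
  by rewrite eqxx.
have [tw' hu'] := ch _ _ iW'; have [tw2 hu2] := ch _ _ iW2.
have [_ hu3] := ch _ _ f5.
have ek : k = lin e (frame_color c b c' b') by rewrite /k eu ev hu.
have et : t = (lin e (addW c c'), b (+) b' (+) frame_third c c').
  by rewrite /t eu ev linB tw.
split.
  rewrite et ek eu ev linB tw tw' tw2 hu' /= hu2 f1 f2 f3 f4 (indep_lin _ _ ie).
  by split.
move=> v2 b2 i2 e2; have [ie2 pe2 [d [d' [eu2 ev2]]]] := chartP i2.
have ik : indep u k by rewrite ek eu indep_lin.
have p1 : plane (u, k) = plane e.
  by apply: plane_eq => //; [rewrite eu | rewrite ek]; apply: mem_plane.
have p2 : plane (u, k) = plane (chart u v2).
  apply: plane_eq => //.
    by have := mem_plane (chart u v2) d; rewrite -eu2.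
  by rewrite -e2 /hue -lock; apply: mem_plane.
have : v2 \in plane e.
  by rewrite -p1 p2; have := mem_plane (chart u v2) d'; rewrite -ev2.
move=> /imsetP[c2 _ ev2']; have iW3 : indepW c c2.
  by rewrite -(indep_lin _ _ ie) -eu -ev2'.
have [_ hu4] := ch _ _ iW3.
move: e2; rewrite ek eu ev2' hu4 => /(lin_inj ie)/(f6 _ _ iW3).
rewrite et ev !inE => /orP[]/eqP[-> ->]; first by rewrite eqxx.
by rewrite eqxx orbT.
Qed.

End Geometry.

(** * The construction *)

Section Construction.
Variable m : nat.
Local Notation V := 'rV[F4]_m.+1.
Local Notation T := (V * bool + bool)%type.
Implicit Types (x y z u v : V) (l : V * V) (P Q R : T) (p q r : U).

Lemma indep_scale (a b : F4) u : ~~ indep (a *: u) (b *: u).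
Proof.
(* The coefficients [(b, a)] give a relation in characteristic 2, which forces [a = 0]; then
   [(1, 0)] is a relation as well. *)
apply/indepP=> h; have /(congr1 snd) /= a0 : (b, a) = (0, 0) :> W.
  by apply: h; rewrite /lin /= !scalerA mulrC add_self.
have /(congr1 fst)/eqP : (1, 0) = (0, 0) :> W.
  by apply: h; rewrite /lin /= a0 !scale0r !scaler0 addr0.
by rewrite oner_eq0.
Qed.

Lemma indep_swap u v : indep u v -> indep v u /\ indep u (u + v).
Proof.
move=> i; pose e := (u, v); have ie : indep e.1 e.2 by [].
have eu : u = lin e (1, 0) by rewrite /lin scale1r scale0r addr0.
have ev : v = lin e (0, 1) by rewrite /lin scale1r scale0r add0r.
have euv : u + v = lin e (1, 1) by rewrite /lin !scale1r.
by split; [rewrite ev eu | rewrite euv eu]; rewrite (indep_lin _ _ ie).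
Qed.

Lemma indep_neq u v : indep u v -> [/\ u != 0, v != 0 & u + v != 0].
Proof.
move=> i; have [i' i2] := indep_swap i; split.
- by apply: contraTneq i => ->; have := indep_scale 0 1 v; rewrite scale0r scale1r.
- by apply: contraTneq i => ->; have := indep_scale 1 0 u; rewrite scale0r scale1r.
- by apply: contraTneq i2 => ->; have := indep_scale 1 0 u; rewrite scale0r scale1r.
Qed.

Lemma ptD l a b : pt l a + pt l b = (a + b) *: l.2.
Proof. by rewrite /pt addrACA add_self add0r -scalerDl. Qed.

Lemma line_dep l x y z : x \in line l -> y \in line l -> z \in line l ->
  ~~ indep (x + y) (x + z).
Proof.
move=> /imsetP[a _ ->] /imsetP[b _ ->] /imsetP[c _ ->].
by rewrite !ptD indep_scale.
Qed.

Lemma line_or_indep x y : x != y -> exists l,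
  [/\ valid l, x \in line l, y \in line l
    & forall z, z \in line l \/ indep (x + y) (x + z)].
Proof.
move=> xy; have d0 : (x, x + y).2 != 0 by rewrite add_eq0.
have [vl el] := canon_valid d0; exists (canon (x, x + y)); rewrite el; split=> //.
- by apply/imsetP; exists 0; rewrite // /pt scale0r addr0.
- by apply/imsetP; exists 1; rewrite // /pt scale1r add_selfK.
move=> z; have [|zl] := boolP (z \in line (x, x + y)); first by left.
right; apply/indepP=> -[a b]; rewrite /lin /= => e.
have [b0|b0] := eqVneq b 0.
  move: e; rewrite b0 scale0r addr0 => /eqP; rewrite scaler_eq0 add_eq0 (negPf xy) orbF.
  by move/eqP->.
(* The relation [a (x + y) + b (x + z) = 0] is solved for [z]. *)
case/negP: zl; apply/imsetP; exists (b^-1 * a) => //; rewrite /pt /=.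
move/eqP: e; rewrite add_eq0 => /eqP e.
by rewrite -scalerA e scalerA mulVf // scale1r add_selfK.
Qed.

Lemma line_at x : exists2 l, valid l & x \in line l.
Proof.
have [y xy] : exists y, x != y.
  (* The dimension [m.+1] is positive, so the all-ones vector is nonzero. *)
  exists (x + const_mx 1); rewrite -add_eq0 add_selfK.
  by apply/eqP=> /rowP/(_ 0); rewrite !mxE.
by have [l [vl xl _ _]] := line_or_indep xy; exists l.
Qed.

(** * The ten points over a line *)

Definition up l (p : U) : T :=
  match p with inl (w, i) => inl (pt l w, i) | inr b => inr b end.
Definition on l P : bool := locked [exists p : U, up l p == P].
(** The default is immaterial: [down l] is applied only to points over [l] or at infinity. *)
Definition down l P : U := locked (odflt (inr false) [pick p : U | up l p == P]).

Lemma onP l P : reflect (exists p, P = up l p) (on l P).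
Proof.
rewrite /on -lock.
by apply: (iffP existsP) => -[p]; [move/eqP<-; exists p | move=> ->; exists p].
Qed.

Lemma on_up l p : on l (up l p).
Proof. by apply/onP; exists p. Qed.

Lemma on_fin l x (i : bool) : on l (inl (x, i)) = (x \in line l).
Proof.
apply/onP/imsetP=> [[[[w j]|//] [-> _]]|[w _ ->]]; first by exists w.
by exists (inl (w, i)).
Qed.

Lemma on_inf l (b : bool) : on l (inr b).
Proof. by apply/onP; exists (inr b). Qed.

Lemma up_inj l : valid l -> injective (up l).
Proof.
move=> /andP[d0 _] [[w i]|b] [[w' i']|b'] //= [].
  by move=> /(pt_inj d0)-> ->.
by move=> ->.
Qed.

Lemma downK l p : valid l -> down l (up l p) = p.
Proof.
move=> vl; rewrite /down -lock; case: pickP => [q /eqP/(up_inj vl) //|/(_ p)].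
by rewrite eqxx.
Qed.

Lemma up_emb l (w : F4) (a : D) : up l (emb w a) = emb (pt l w) a.
Proof. by case: a => [[] b]. Qed.

Lemma emb_inj (X : Type) (x : X) : injective (emb x).
Proof. by move=> [[] b] [[] b'] //= [->]. Qed.

Lemma on_two l l' x y (i j : bool) : valid l -> valid l' ->
  on l (inl (x, i)) -> on l (inl (y, j)) -> on l' (inl (x, i)) -> on l' (inl (y, j)) ->
  l = l' \/ x = y.
Proof.
rewrite !on_fin => vl vl' xl yl xl' yl'; have [->|xy] := eqVneq x y; first by right.
left; apply: valid_eq => //; have /andP[d0 _] := vl; have /andP[d0' _] := vl'.
exact: line_eq xl yl xl' yl'.
Qed.

Lemma common_pair l l' P Q : valid l -> valid l' ->
  on l P -> on l Q -> on l' P -> on l' Q ->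
  l = l' \/ exists x a b, P = emb x a /\ Q = emb x b.
Proof.
move=> vl vl'; case: P Q => [[x i]|i] [[y j]|j] h1 h2 h3 h4.
- have [->|->] := on_two vl vl' h1 h2 h3 h4; first by left.
  by right; exists y, (false, i), (false, j).
- by right; exists x, (false, i), (true, j).
- by right; exists y, (true, i), (false, j).
(* Points at infinity count as lying over every vector; 0 is an arbitrary choice. *)
- by right; exists 0, (true, i), (true, j).
Qed.

(** Distinct lines meet in at most one vector, so what they share lies over that vector or at
    infinity. *)
Lemma common_triple l l' P Q R : valid l -> valid l' ->
  on l P -> on l Q -> on l R -> on l' P -> on l' Q -> on l' R ->
  l = l' \/ exists x a b c, [/\ P = emb x a, Q = emb x b & R = emb x c].
Proof.
move=> vl vl'; case: P Q R => [[x i]|i] [[y j]|j] [[z k]|k] P1 Q1 R1 P2 Q2 R2.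
- have [->|->] := on_two vl vl' P1 Q1 P2 Q2; first by left.
  have [->|->] := on_two vl vl' Q1 R1 Q2 R2; first by left.
  by right; exists z, (false, i), (false, j), (false, k).
- have [->|->] := on_two vl vl' P1 Q1 P2 Q2; first by left.
  by right; exists y, (false, i), (false, j), (true, k).
- have [->|->] := on_two vl vl' P1 R1 P2 R2; first by left.
  by right; exists z, (false, i), (true, j), (false, k).
- by right; exists x, (false, i), (true, j), (true, k).
- have [->|->] := on_two vl vl' Q1 R1 Q2 R2; first by left.
  by right; exists z, (true, i), (false, j), (false, k).
- by right; exists y, (true, i), (false, j), (true, k).
- by right; exists z, (true, i), (true, j), (false, k).
- by right; exists 0, (true, i), (true, j), (true, k).
Qed.

(** * Completion and colours of triples *)

Definition common_line P Q R : option (V * V) :=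
  [pick l : V * V | [&& valid l, on l P, on l Q & on l R]].

(** Colours become vectors along the line at a finite point, and points of the line at infinity.
    Either way distinct lines through [x] share only the colour of the block over [x]. *)
Definition tint l P (w : F4) : V := if P is inl _ then w *: l.2 else pt l w.

(** By [tripleP] the final default is not reached for distinct points. *)
Definition complete P Q R : T :=
  if common_line P Q R is Some l then up l (complete10 (down l P) (down l Q) (down l R))
  else match P, Q, R with
  | inl (x, i), inl (y, j), inl (z, k) =>
      inl (x + y + z, i (+) j (+) k (+) twist (x + y) (x + z))
  | _, _, _ => P
  end.

Definition color P Q R : V :=
  if common_line P Q R is Some l then tint l P (color10 (down l P) (down l Q) (down l R))
  else match P, Q, R with
  | inl (x, i), inl (y, j), inl (z, k) => hue (x + y) (i (+) j) (x + z) (i (+) k)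
  | _, _, _ => 0
  end.

Lemma uniq_up l p q r : valid l ->
  uniq [:: up l p; up l q; up l r] = uniq [:: p; q; r].
Proof. by move=> vl; rewrite -(map_inj_uniq (up_inj vl)). Qed.

Lemma uniq_emb (X : eqType) (x : X) (a b c : D) :
  uniq [:: emb x a : X * bool + bool; emb x b; emb x c] = uniq [:: a; b; c].
Proof. by rewrite -(map_inj_uniq (@emb_inj X x)). Qed.

Lemma emb_on l x (a b c : D) : uniq [:: a; b; c] ->
  on l (emb x a) -> on l (emb x b) -> on l (emb x c) -> x \in line l.
Proof.
by case: a b c => [[] []] [[] []] [[] []] //= _; rewrite ?on_fin.
Qed.

Lemma emb_values l x (a b c : D) : valid l -> uniq [:: a; b; c] -> x \in line l ->
  up l (complete10 (down l (emb x a)) (down l (emb x b)) (down l (emb x c))) =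
    emb x (fourth a b c) /\
  tint l (emb x a) (color10 (down l (emb x a)) (down l (emb x b)) (down l (emb x c))) =
    if a.1 then x else 0.
Proof.
move=> vl u /imsetP[w _ ->] /=; rewrite -!up_emb !downK // !up_emb.
have [-> ->] := local10_emb w u; rewrite up_emb; split=> //.
by case: a {u} => [[] i] //=; rewrite scale0r.
Qed.

(** [common_line] may choose another line, but then the three points lie over a single vector, where
    [emb_values] gives the same result for both lines. *)
Lemma complete_up l p q r : valid l -> uniq [:: p; q; r] ->
  complete (up l p) (up l q) (up l r) = up l (complete10 p q r) /\
  color (up l p) (up l q) (up l r) = tint l (up l p) (color10 p q r).
Proof.
move=> vl u; rewrite /complete /color /common_line.
case: pickP => [l' /and4P[vl' P' Q' R']|/(_ l)]; last by rewrite vl !on_up.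
have [<-|[x [a [b [c [eP eQ eR]]]]]] :=
  common_triple vl vl' (on_up l p) (on_up l q) (on_up l r) P' Q' R'.
  by rewrite !downK.
have u' : uniq [:: a; b; c].
  by rewrite -(uniq_emb x) -eP -eQ -eR uniq_up.
have oP := on_up l p; have oQ := on_up l q; have oR := on_up l r.
have := (downK p vl, downK q vl, downK r vl).
rewrite eP eQ eR in P' Q' R' oP oQ oR * => -[[dp dq] dr].
have := emb_values vl u' (emb_on u' oP oQ oR).
rewrite dp dq dr => -[-> ->].
by have [-> ->] := emb_values vl' u' (emb_on u' P' Q' R').
Qed.

Lemma complete_plane x y z (i j k : bool) : indep (x + y) (x + z) ->
  complete (inl (x, i)) (inl (y, j)) (inl (z, k)) =
    inl (x + y + z, i (+) j (+) k (+) twist (x + y) (x + z)) /\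
  color (inl (x, i)) (inl (y, j)) (inl (z, k)) = hue (x + y) (i (+) j) (x + z) (i (+) k).
Proof.
move=> ind; rewrite /complete /color /common_line; case: pickP => // l /and4P[_].
by rewrite !on_fin => xl yl zl; have := line_dep xl yl zl; rewrite ind.
Qed.

Variant triple_spec : T -> T -> T -> Prop :=
| CollinearTriple l p q r of valid l & uniq [:: p; q; r] :
    triple_spec (up l p) (up l q) (up l r)
| PlanarTriple x y z i j k of indep (x + y) (x + z) :
    triple_spec (inl (x, i)) (inl (y, j)) (inl (z, k)).

Lemma tripleP P Q R : uniq [:: P; Q; R] -> triple_spec P Q R.
Proof.
move=> uPQR.
have col l : valid l -> on l P -> on l Q -> on l R -> triple_spec P Q R.
  move=> vl /onP[p eP] /onP[q eQ] /onP[r eR]; move: uPQR; rewrite eP eQ eR.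
  by rewrite uniq_up // => u; constructor.
have near x a b c : P = emb x a -> Q = emb x b -> R = emb x c -> triple_spec P Q R.
  move=> eP eQ eR; have [l vl xl] := line_at x.
  have onl d : on l (emb x d) by case: d => [[] d]; rewrite ?on_inf ?on_fin.
  by apply: (col l) => //; rewrite ?eP ?eQ ?eR.
have two x y : x != y -> exists l, [/\ valid l, x \in line l & y \in line l].
  by move=> /line_or_indep[l [vl xl yl _]]; exists l.
case: P Q R uPQR col near => [[x i]|i] [[y j]|j] [[z k]|k] uPQR col near.
- have [exy|xy] := eqVneq x y; last first.
    have [l [vl xl yl /(_ z)[zl|ind]]] := line_or_indep xy; last by constructor.
    by apply: (col l); rewrite ?on_fin.
  have [exz|xz] := eqVneq x z.
    by apply: (near x (false, i) (false, j) (false, k)); rewrite ?exz -?exy // exz.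
  by have [l [vl xl zl]] := two _ _ xz; apply: (col l); rewrite ?on_fin -?exy.
- have [exy|xy] := eqVneq x y.
    by apply: (near x (false, i) (false, j) (true, k)); rewrite -?exy.
  by have [l [vl xl yl]] := two _ _ xy; apply: (col l); rewrite ?on_fin ?on_inf.
- have [exz|xz] := eqVneq x z.
    by apply: (near x (false, i) (true, j) (false, k)); rewrite -?exz.
  by have [l [vl xl zl]] := two _ _ xz; apply: (col l); rewrite ?on_fin ?on_inf.
- exact: (near x (false, i) (true, j) (true, k)).
- have [eyz|yz] := eqVneq y z.
    by apply: (near y (true, i) (false, j) (false, k)); rewrite -?eyz.
  by have [l [vl yl zl]] := two _ _ yz; apply: (col l); rewrite ?on_fin ?on_inf.
- exact: (near y (true, i) (false, j) (true, k)).
- exact: (near z (true, i) (true, j) (false, k)).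
- exact: (near 0 (true, i) (true, j) (true, k)).
Qed.

(** Over a line these are facts about SQS(10). In the planar case put [u = x + y] and [v = x + z]:
    the rearrangements replace [(u, v)] by [(v, u)] or [(u, u + v)], and [hueP] gives the
    invariance. *)
Lemma quad_identities P Q R : uniq [:: P; Q; R] ->
  [/\ complete P Q R \notin [:: P; Q; R], complete Q P R = complete P Q R
    & complete P R Q = complete P Q R] /\
  [/\ complete P Q (complete P Q R) = R, color P R Q = color P Q R
    & color P Q (complete P Q R) = color P Q R].
Proof.
move=> /tripleP[l p q r vl u|x y z i j k ind].
  have /uniq3P[pq pr qr] := u.
  have u1 : uniq [:: q; p; r] by apply/uniq3P; split=> // /esym.
  have u2 : uniq [:: p; r; q] by apply/uniq3P; split=> // /esym.
  have nq := q_new resolved10 u.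
  have u3 : uniq [:: p; q; complete10 p q r].
    move: nq; rewrite !inE !negb_or => /and3P[/eqP e1 /eqP e2 _].
    by apply/uniq3P; split=> // /esym.
  have [-> ->] := complete_up vl u; have [-> _] := complete_up vl u1.
  have [-> ->] := complete_up vl u2.
  have [-> ->] := complete_up vl u3.
  rewrite (q_swap12 resolved10 u) (q_swap23 resolved10 u) (q_inv resolved10 u).
  rewrite (chi_swap resolved10 u) (chi_q resolved10 u); do !split=> //.
  by rewrite -[[:: _; _; _]]/(map (up l) [:: p; q; r]) mem_map //; apply: up_inj.
have [ind' ind2] := indep_swap ind.
have yz : y + z = (x + y) + (x + z) by rewrite addrACA add_self add0r.
have xyz : x + (x + y + z) = (x + y) + (x + z) by rewrite -yz addrA add_selfK.
have [[t1 t2 h1 h2 _] _] := hueP (i (+) j) (i (+) k) ind.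
set tw := twist (x + y) (x + z) in t1 t2 h2 *.
have indS : indep (x + y) (x + (x + y + z)) by rewrite xyz.
have indQ : indep (y + x) (y + z) by rewrite (addrC y x) yz.
have [-> ->] := complete_plane i j k ind; have [-> _] := complete_plane j i k indQ.
have [-> ->] := complete_plane i k j ind'.
have [-> ->] := complete_plane i j (i (+) j (+) k (+) tw) indS.
have eb : i (+) (i (+) j (+) k (+) tw) = i (+) j (+) (i (+) k) (+) tw.
  by case: (i) (j) (k) (tw) => [] [] [] [].
rewrite /= in h2; rewrite xyz yz eb h1 h2 (addrC y x) t1 t2.
split; last first.
  split; [|reflexivity|reflexivity].
  congr (inl (_, _)); first exact: add_selfK.
  by rewrite -/tw; case: (i) (j) (k) (tw) => [] [] [] [].
split.
- have [n1 n2 n3] := indep_neq ind; rewrite !inE !negb_or; apply/and3P; split.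
  + by apply: contraNneq n3 => -[e _]; rewrite -xyz e add_self.
  + apply: contraNneq n2 => -[e _]; rewrite -(add_selfK y (x + z)).
    by rewrite [y + (x + z)]addrCA addrA e add_self.
  + apply: contraNneq n1 => -[e _].
    by rewrite -(addr0 (x + y)) -(add_self z) addrA e add_self.
- by rewrite (addbC j).
- by rewrite addrAC (addbAC i k).
Qed.

(** * Injectivity of the colours *)

Lemma tint_inj l P : valid l -> injective (tint l P).
Proof.
move=> /andP[d0 _]; case: P => [[x i]|b] w w'; last exact: pt_inj.
by move=> /= e; apply: (pt_inj d0); rewrite /pt e.
Qed.

(* In the second case x and the colour determine the line l. *)
Lemma emb_color l x (a b : D) (r : U) : valid l -> x \in line l -> a != b ->
  uniq [:: emb x a; emb x b; up l r] ->
  let w := color (emb x a) (emb x b) (up l r) in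
  (exists c : D, up l r = emb x c) \/
  (if a.1 then w else x + w) \in line l /\ (if a.1 then w else x + w) != x.
Proof.
move=> vl /imsetP[w _ ->] ab; rewrite -!up_emb uniq_up // => u.
have [_ ->] := complete_up vl u; cbv zeta.
have [c uc] : exists c : D, uniq [:: a; b; c].
  have [c hc|h] := pickP [pred c : D | uniq [:: a; b; c]]; first by exists c.
  have := (h (false, false), h (false, true), h (true, false), h (true, true)).
  by case: (a) (b) ab => [[] []] [[] []] // _ [[[]]].
have uw : uniq [:: emb w a : U; emb w b; emb w c] by rewrite uniq_emb.
have [eq ek] := local10_emb w uc.
(* If [r] has the colour of the block over the point, [chi_inj] places it in that block. *)
have [e|ne] := eqVneq (color10 (emb w a) (emb w b) r) (if a.1 then w else 0).
  left; have := chi_inj resolved10 uw u; rewrite ek e => /(_ erefl).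
  rewrite !inE eq => /orP[]/eqP->; rewrite up_emb; first by exists c.
  by exists (fourth a b c).
right; case: a {u uc uw eq ek ab} ne => [[] i] /= ne.
  rewrite mem_line; split=> //; apply: contraNneq ne => /pt_inj.
  by case/andP: vl => d0 _ /(_ d0)->.
rewrite /pt -addrA -scalerDl mem_line; split=> //.
rewrite -subr_eq0 opp_self -/(pt l w) ptD scaler_eq0 (negPf (proj1 (andP vl))) orbF.
by rewrite addrAC F4_add_self add0r.
Qed.

Lemma complete_emb x (a b c : D) : uniq [:: a; b; c] ->
  complete (emb x a) (emb x b) (emb x c) = emb x (fourth a b c) /\
  color (emb x a) (emb x b) (emb x c) = if a.1 then x else 0.
Proof.
move=> u; have [l vl /imsetP[w _ ->]] := line_at x; rewrite -!up_emb.
have uw : uniq [:: emb w a : U; emb w b; emb w c] by rewrite uniq_emb.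
have [-> ->] := complete_up vl uw; have [-> ->] := local10_emb w u; split=> //.
by case: a {u uw} => [[] i] //=; rewrite scale0r.
Qed.

Lemma fourth_last (a b c c' : D) : uniq [:: a; b; c] -> uniq [:: a; b; c'] ->
  c' \in [:: c; fourth a b c].
Proof. by case: a b c c' => [[] []] [[] []] [[] []] [[] []]. Qed.

Lemma color_inj_emb x (a b c c' : D) P Q R R' :
  P = emb x a -> Q = emb x b -> R = emb x c -> R' = emb x c' ->
  uniq [:: P; Q; R] -> uniq [:: P; Q; R'] -> R' \in [:: R; complete P Q R].
Proof.
move=> -> -> -> ->; rewrite !uniq_emb => u u'; have [-> _] := complete_emb x u.
by rewrite -[[:: _; _]]/(map (emb x) [:: c; _]) mem_map ?fourth_last //; apply: emb_inj.
Qed.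

Lemma color_inj_line l P Q R R' : valid l -> on l P -> on l Q -> on l R -> on l R' ->
  uniq [:: P; Q; R] -> uniq [:: P; Q; R'] ->
  color P Q R = color P Q R' -> R' \in [:: R; complete P Q R].
Proof.
move=> vl /onP[p ->] /onP[q ->] /onP[r ->] /onP[r' ->]; rewrite !uniq_up // => u u'.
have [-> ->] := complete_up vl u; have [_ ->] := complete_up vl u'; move=> /(tint_inj vl) e.
rewrite -[[:: _; _]]/(map (up l) [:: r; _]) mem_map; last exact: up_inj.
exact: (chi_inj resolved10).
Qed.

(** The colour from the line is a multiple of its direction, as is [x + y], whereas [hue] is
    independent of [x + y]. *)
Lemma color_line_plane l x y z (i j k : bool) R : valid l ->
  on l (inl (x, i)) -> on l (inl (y, j)) -> on l R ->
  uniq [:: inl (x, i); inl (y, j); R] -> indep (x + y) (x + z) ->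
  color (inl (x, i)) (inl (y, j)) R <> color (inl (x, i)) (inl (y, j)) (inl (z, k)).
Proof.
move=> vl xl yl /onP[r ->] u ind.
have := xl; rewrite on_fin => /imsetP[w _ ex].
have := yl; rewrite on_fin => /imsetP[w' _ ey].
have [[p ep] [q eq]] := (onP _ _ xl, onP _ _ yl).
rewrite ep eq uniq_up // in u; have [_] := complete_up vl u; rewrite -ep -eq => ->.
have [_ ->] := complete_plane i j k ind => e.
have [[_ _ _ _]] := hueP (i (+) j) (i (+) k) ind.
by rewrite -e /= ex ey ptD (negPf (indep_scale _ _ _)).
Qed.

(** If the lines differ, [P] and [Q] lie over one vector [x]. Then either both third points lie over
    [x], or the common colour gives a second common point of the lines. *)
Lemma color_inj_lines l l' P Q R R' : valid l -> valid l' ->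
  on l P -> on l Q -> on l R -> on l' P -> on l' Q -> on l' R' ->
  uniq [:: P; Q; R] -> uniq [:: P; Q; R'] ->
  color P Q R = color P Q R' -> R' \in [:: R; complete P Q R].
Proof.
move=> vl vl' P1 Q1 R1 P2 Q2 R2 u u' e.
have same : l = l' -> R' \in [:: R; complete P Q R].
  by move=> ll; apply: (color_inj_line vl) => //; rewrite ll.
have [//|[x [a [b [eP eQ]]]]] := common_pair vl vl' P1 Q1 P2 Q2.
have ab : a != b.
  by apply: contraTneq u => ab; rewrite eP eQ ab /= inE eqxx.
(* If [P] and [Q] are the two points at infinity, [x] is arbitrary; they can be read as lying over
   the vector of the third point, which is then the colour. *)
case: (boolP (a.1 && b.1)) => [|inf].
  case: a b {ab} eP eQ => [[] i] [[] j] // eP eQ _.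
  case: R R' {R1 R2 same} u u' e => [[z k]|k] [[z' k']|k'] u u' e; last 3 first.
  - by move: u'; rewrite eP eQ; case: (i) (j) (k') => [] [] [].
  - by move: u; rewrite eP eQ; case: (i) (j) (k) => [] [] [].
  - by move: u; rewrite eP eQ; case: (i) (j) (k) => [] [] [].
  have zz : z = z'.
    have colorE t (d : bool) : uniq [:: P; Q; inl (t, d)] -> color P Q (inl (t, d)) = t.
      rewrite eP eQ -[emb x (true, i)]/(emb t (true, i)).
      rewrite -[emb x (true, j)]/(emb t (true, j)).
      by rewrite -[inl _]/(emb t (false, d)) uniq_emb => v; have [_ ->] := complete_emb t v.
    by rewrite -(colorE _ _ u) e colorE.
  by apply: (@color_inj_emb z (true, i) (true, j) (false, k) (false, k')) => //; rewrite zz.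
have online k : on k P -> on k Q -> x \in line k.
  by rewrite eP eQ; case: (a) (b) inf => [[] ?] [[] ?]; rewrite ?on_fin.
have xl := online _ P1 Q1; have xl' := online _ P2 Q2.
have [[r eR] [r' eR']] := (onP _ _ R1, onP _ _ R2).
have := emb_color vl xl ab; have := emb_color vl' xl' ab.
rewrite -eP -eQ => /(_ r'); rewrite -eR' => /(_ u') c2 /(_ r); rewrite -eR => /(_ u) c1.
(* Third points over [x] give the value [x], which [emb_color] excludes for all others; this rules
   out the mixed cases. *)
have special c S : S = emb x c -> uniq [:: P; Q; S] ->
    (if a.1 then color P Q S else x + color P Q S) = x.
  move=> -> + ; rewrite eP eQ uniq_emb => v; have [_ ->] := complete_emb x v.
  by case: (a.1); rewrite ?addr0.
case: c1 c2 => [[c ec]|[m1 n1]] [[c' ec']|[m2 n2]].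
- exact: (color_inj_emb eP eQ ec ec').
- by move: n2; rewrite -e (special _ _ ec u) eqxx.
- by move: n1; rewrite e (special _ _ ec' u') eqxx.
- apply: same; apply: valid_eq => //; rewrite -e in m2.
  by apply: line_eq n1 m1 xl m2 xl'; [case/andP: vl | case/andP: vl'].
Qed.

(** Triples over lines are compared by [color_inj_lines] and planar ones by [hueP]; a mixed pair is
    excluded by [color_line_plane]. *)
Lemma color_inj P Q R R' : uniq [:: P; Q; R] -> uniq [:: P; Q; R'] ->
  color P Q R = color P Q R' -> R' \in [:: R; complete P Q R].
Proof.
have cases S : uniq [:: P; Q; S] ->
    (exists l, [/\ valid l, on l P, on l Q & on l S]) \/
    (exists x y z i j k, [/\ P = inl (x, i), Q = inl (y, j), S = inl (z, k)
       & indep (x + y) (x + z)]).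
  case/tripleP=> [l p q r vl _|x y z i j k ind].
    by left; exists l; rewrite !on_up.
  by right; exists x, y, z, i, j, k.
move=> u u'; case: (cases _ u) (cases _ u').
  move=> [l [vl P1 Q1 R1]] [[l' [vl' P2 Q2 R2]]|].
    exact: (color_inj_lines vl vl').
  move=> [x [y [z [i [j [k [eP eQ eR' ind]]]]]]].
  by rewrite eP eQ in P1 Q1 u *; rewrite eR' => /(color_line_plane vl P1 Q1 R1 u ind).
move=> [x [y [z [i [j [k [eP eQ eR ind]]]]]]] [[l [vl P2 Q2 R2]]|].
  by rewrite eP eQ in P2 Q2 u' *; rewrite eR => /esym/(color_line_plane vl P2 Q2 R2 u' ind).
move=> [x' [y' [z' [i' [j' [k' [eP' eQ' -> ind']]]]]]]; rewrite eR.
move: eP' eQ'; rewrite eP eQ => -[ex ei] [ey ej]; subst x' i' y' j'.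
have [-> ->] := complete_plane i j k ind.
have [_ ->] := complete_plane i j k' ind' => /esym.
have [_ inj] := hueP (i (+) j) (i (+) k) ind; move=> /(inj _ _ ind').
rewrite !inE => /orP[]/eqP[ez ek]; apply/orP; [left|right]; apply/eqP.
  by congr (inl (_, _)); [exact: addrI ez | exact: can_inj (addKb i) _ _ ek].
congr (inl (_, _)).
  by apply: (@addrI _ x); rewrite ez addrCA.
by apply: (can_inj (addKb i)); rewrite ek; case: (i) (j) (k) (twist _ _) => [] [] [] [].
Qed.

Lemma complete_resolved : resolved_quads complete color.
Proof.
by split=> [P Q R|P Q R|P Q R|P Q R|P Q R|P Q R|]; last exact: color_inj;
  move=> /quad_identities[[? ? ?] [? ? ?]].
Qed.

End Construction.

Local Close Scope ring_scope.

(** Dimension 0 has no lines and is treated directly: there is one block, so each derived design is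
    a single triple and one colour suffices. *)
Lemma RDSQS_4 : RDSQS_exists 4.
Proof.
have cD : #|{: D}| = 4%N by rewrite card_prod card_bool.
rewrite -cD; apply: (@resolved_quads_RDSQS D unit fourth (fun _ _ _ => tt)).
  split=> //; try by case=> [[] []] [[] []] [[] []].
  by move=> a y z z' u u' _; apply: fourth_last.
by rewrite cD card_unit.
Qed.

Theorem theorem3p2 : forall n : nat, RDSQS_exists (2 ^ (2 * n + 1) + 2).
Proof.
case=> [|m]; first exact: RDSQS_4.
have cV : #|{: 'rV[F4]_m.+1}| = (2 ^ (2 * m.+1))%N.
  by rewrite card_mx card_prod card_bool mul1n expnM.
have cT : #|{: 'rV[F4]_m.+1 * bool + bool}| = (2 ^ (2 * m.+1) * 2 + 2)%N.
  by rewrite card_sum card_prod cV card_bool.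
rewrite addn1 expnSr -cT; apply: (resolved_quads_RDSQS (@complete_resolved m)).
(* The colours are the vectors, so the points number twice the colours plus 2. *)
by rewrite cT cV addn2 muln2.
Qed.
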